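(* Every nearly atomic monoid is almost atomic.
   Context: A monoid is a cancellative, commutative semigroup with identity, written additively (identity $0$). For a monoid $M$, $\mathcal{U}(M)$ is the group of invertible elements, and $\mathrm{gp}(M)$ is the difference group of $M$ (the group of formal differences of elements of $M$, containing $M$). For $S\subseteq M$, $\langle S\rangle$ is the smallest submonoid of $M$ containing $S$. An element $a\in M\setminus\mathcal{U}(M)$ is an atom if whenever $a=r+s$ with $r,s\in M$, either $r\in\mathcal{U}(M)$ or $s\in\mathcal{U}(M)$; $\mathcal{A}(M)$ is the set of atoms. A non-invertible element $b\in M$ is atomic if $b\in\langle\mathcal{A}(M)\rangle$, and almost atomic if $b\in\mathrm{gp}(\langle\mathcal{A}(M)\rangle)$, viewed as a subgroup of $\mathrm{gp}(M)$. $M$ is almost atomic if every non-invertible element of $M$ is almost atomic. $M$ is nearly atomic if there exists $b\in M$ such that $b+m$ is atomic for all $m\in M$. *)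

(* Defs.v *)
From HB Require Import structures.
From mathcomp Require Import all_boot all_algebra.
From mathcomp Require Import boolp classical_sets.

Set Implicit Arguments.
Unset Strict Implicit.
Unset Printing Implicit Defensive.

Import GRing.Theory.
Local Open Scope ring_scope.
Local Open Scope quotient_scope.
Local Open Scope classical_set_scope.

HB.mixin Record Nmodule_isCancellative M of GRing.Nmodule M := {
  addm_inj : forall x : M, injective (+%R x)
}.

#[short(type="cancelNmodType")]
HB.structure Definition CancelNmodule :=
  { M of GRing.Nmodule M & Nmodule_isCancellative M }.

Section DifferenceGroup.
Variable M : cancelNmodType.

(* The pair (a, b) stands for the formal difference a - b. *)
Definition equivd (x y : M * M) := x.1 + y.2 == y.1 + x.2.

Lemma equivd_refl : reflexive equivd.
Proof. by move=> x; rewrite /equivd. Qed.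

Lemma equivd_sym : symmetric equivd.
Proof. by move=> x y; rewrite /equivd eq_sym. Qed.

Lemma equivd_trans : transitive equivd.
Proof.
move=> y x z /eqP xy /eqP yz; apply/eqP/(@addm_inj _ y.2).
by rewrite addrA [y.2 + _]addrC xy addrAC yz addrAC addrC.
Qed.

Canonical equivd_equiv := EquivRel equivd equivd_refl equivd_sym equivd_trans.

Definition gp := {eq_quot equivd}.

HB.instance Definition _ : EqQuotient _ equivd gp := EqQuotient.on gp.
HB.instance Definition _ := Choice.on gp.

Definition gp_zero : gp := \pi_gp (0, 0).
Definition gp_add : gp -> gp -> gp :=
  lift_op2 gp (fun x y : M * M => (x.1 + y.1, x.2 + y.2)).
Definition gp_opp : gp -> gp := lift_op1 gp (fun x : M * M => (x.2, x.1)).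

Lemma pi_gp_add (x y : M * M) :
  gp_add (\pi_gp x) (\pi_gp y) = \pi_gp (x.1 + y.1, x.2 + y.2).
Proof.
unlock gp_add; apply/eqmodP; rewrite /= /equivd /=.
have : repr (\pi_gp x) == x %[mod gp] by rewrite reprK.
have : repr (\pi_gp y) == y %[mod gp] by rewrite reprK.
rewrite !eqmodE /= /equivd => /eqP ey /eqP ex.
by rewrite addrACA ex ey addrACA.
Qed.

Lemma pi_gp_opp (x : M * M) : gp_opp (\pi_gp x) = \pi_gp (x.2, x.1).
Proof.
unlock gp_opp; apply/eqmodP; rewrite /= /equivd /=.
have : repr (\pi_gp x) == x %[mod gp] by rewrite reprK.
by rewrite eqmodE /= /equivd => /eqP ex; rewrite addrC -ex addrC.
Qed.

Lemma gp_addA : associative gp_add.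
Proof.
by elim/quotW=> x; elim/quotW=> y; elim/quotW=> z; rewrite !pi_gp_add /= !addrA.
Qed.

Lemma gp_addC : commutative gp_add.
Proof.
by elim/quotW=> x; elim/quotW=> y; rewrite !pi_gp_add addrC [x.2 + _]addrC.
Qed.

Lemma gp_add0 : left_id gp_zero gp_add.
Proof. by elim/quotW=> x; rewrite pi_gp_add /= !add0r -surjective_pairing. Qed.

Lemma gp_addN : left_inverse gp_zero gp_opp gp_add.
Proof.
elim/quotW=> x; rewrite pi_gp_opp pi_gp_add /gp_zero; apply/eqmodP.
by rewrite /= /equivd /= addr0 add0r addrC.
Qed.

HB.instance Definition _ :=
  GRing.isZmodule.Build gp gp_addA gp_addC gp_add0 gp_addN.

Definition to_gp (a : M) : gp := \pi_gp (a, 0).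

Lemma to_gp_nmod_morphism : nmod_morphism to_gp.
Proof.
split=> // a b; apply/esym/(etrans (pi_gp_add _ _)).
by rewrite /to_gp /= addr0.
Qed.

HB.instance Definition _ :=
  GRing.isNmodMorphism.Build M gp to_gp to_gp_nmod_morphism.

Lemma to_gp_inj : injective to_gp.
Proof.
by move=> a b /eqP; rewrite eqmodE /= /equivd /= !addr0 => /eqP.
Qed.

Lemma to_gpB (z : gp) : exists a b, z = to_gp a - to_gp b.
Proof.
elim/quotW: z => x; exists x.1, x.2.
rewrite /to_gp [- _]pi_gp_opp; apply/esym/(etrans (pi_gp_add _ _)).
by rewrite /= add0r addr0 -surjective_pairing.
Qed.

End DifferenceGroup.

Section AtomicNotions.
Context {M : cancelNmodType}.
Implicit Types (S : set M) (a b : M).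

Definition submonoid S := S 0 /\ forall a b, S a -> S b -> S (a + b).

Definition gen S : set M := smallest submonoid S.

(* For a submonoid S, the difference group of S viewed inside gp M. *)
Definition sub_gp S : set (gp M) :=
  [set z | exists s t, [/\ S s, S t & z = to_gp s - to_gp t]].

Definition invertible a := exists b, a + b = 0.

Definition atom a :=
  ~ invertible a /\ forall r s, a = r + s -> invertible r \/ invertible s.

Definition atoms : set M := [set a | atom a].

Definition atomic b := ~ invertible b /\ gen atoms b.

Definition almost_atomic b :=
  ~ invertible b /\ sub_gp (gen atoms) (to_gp b).

End AtomicNotions.

Definition almost_atomic_monoid (M : cancelNmodType) :=
  forall b : M, ~ invertible b -> almost_atomic b.

Definition nearly_atomic_monoid (M : cancelNmodType) :=
  exists b : M, forall m : M, atomic (b + m).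

(* Main.v *)
Require Import Defs.
From mathcomp Require Import all_boot all_algebra.
From mathcomp Require Import boolp classical_sets.

(** If [b] shifts every element of [M] to an atomic one, then [b] itself (the
    shift of 0) and [b + c] both lie in the submonoid generated by the atoms,
    and [c] is their difference [(b + c) - b]: a single translation by [b]
    exhibits any element as a formal difference of sums of atoms. *)
Theorem proposition4p1 (M : cancelNmodType) :
  nearly_atomic_monoid M -> almost_atomic_monoid M.
Proof.
move=> [b atomic_shift] c c_noninv; split=> //.
have [_ gen_bc] := atomic_shift c.
have [_ gen_b] := atomic_shift 0%R.
rewrite GRing.addr0 in gen_b.
exists (b + c)%R, b; split=> //.
by rewrite GRing.raddfD GRing.addrC GRing.addKr.
Qed.
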